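(* Let $(P_X,P_{Y|X})$ be an input/channel pair and $\Theta_0\sim\mathcal U$. Consider the transmission scheme $X_{n+1}=g_{n+1}(\Theta_0,Y^n)$ with $g_{n+1}(\theta,y^n)=F_X^{-1}\big(F_{\Theta_0|Y^n}(\theta\,|\,y^n)\big)$ for $n\ge0$ (so $X_1=F_X^{-1}(\Theta_0)$), used over the memoryless channel $P_{Y|X}$. Then for every $n\ge 0$: the random variable $U_n\triangleq F_{\Theta_0|Y^n}(\Theta_0|Y^n)$ is uniform on $(0,1)$ and statistically independent of $Y^n$; $\Theta_0$ can be a.s. uniquely recovered from $(U_n,Y^n)$; and consequently $X_{n+1}\sim P_X$ and $X_{n+1}$ is independent of $Y^n$.
   Context: All real r.v.'s are mixtures of absolutely continuous and discrete parts. $F_X$ is the c.d.f. of $X$, $F_X^{-1}(t)=\inf\{x:F_X(x)>t\}$; $\mathcal U$ is the uniform distribution on $(0,1)$. A memoryless channel is a conditional distribution $P_{Y|X}$ on $\mathbb R$; its input alphabet is the set of $x$ for which $P_{Y|X}(\cdot|x)$ is defined. An input/channel pair $(P_X,P_{Y|X})$ is one with $\mathrm{supp}(X)$ contained in the input alphabet and $I(X;Y)<\infty$. Transmission over the channel means $P_{Y_n|X^nY^{n-1}}(\cdot|x^n,y^{n-1})=P_{Y|X}(\cdot|x_n)$. $F_{\Theta_0|Y^n}(\cdot|y^n)$ is the posterior c.d.f. of the message point $\Theta_0$ given the outputs $Y^n=y^n$.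
   Formalization: Transmission is taken as: given (Θ0,Y^n), Y_{n+1} has law P_{Y|X}(·|X_{n+1}); conditioning only on (X^{n+1},Y^n), the claim can fail as outputs may depend on Θ0 otherwise. The channel is defined for all real inputs (extend it arbitrarily off supp(X)). *)

(* Defs.v *)
From HB Require Import structures.
From mathcomp Require Import all_boot all_order all_algebra.
From mathcomp Require Import all_classical all_reals all_analysis.
Set Implicit Arguments. Unset Strict Implicit. Unset Printing Implicit Defensive.
Import Order.TTheory GRing.Theory Num.Theory.
Import numFieldNormedType.Exports.
Local Open Scope classical_set_scope.
Local Open Scope ring_scope.

Section defs.
Variable R : realType.

Definition cdf (mu : probability R R) (x : R) : R := fine (mu [set` `]-oo, x]]).

Definition cdf_inv (mu : probability R R) (t : R) : R :=
  inf [set x : R | t < cdf mu x].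

Definition ac_discrete_mixture (mu : set R -> \bar R) : Prop :=
  exists (a : nat -> R) (w : nat -> R) (f : R -> R),
    (forall k, 0 <= w k) /\ measurable_fun setT f /\ (forall x, 0 <= f x) /\
    forall A : set R, measurable A ->
      mu A = ((\sum_(0 <= k <oo) ((w k)%:E * (\1_A (a k))%:E)) +
              \int[lebesgue_measure]_(x in A) (f x)%:E)%E.

Definition meas_partition (m : nat) (A : 'I_m -> set R) : Prop :=
  (forall i, measurable (A i)) /\
  (forall i j, i != j -> A i `&` A j = set0) /\
  (forall x, exists i, A i x).

Definition joint_rect (PX : probability R R) (K : R.-pker R ~> R)
  (A B : set R) : R := fine (\int[PX]_(x in A) K x B)%E.
Definition out_prob (PX : probability R R) (K : R.-pker R ~> R)
  (B : set R) : R := fine (\int[PX]_x K x B)%E.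

(* I(X;Y) < oo, with I(X;Y) defined (Dobrushin / Gelfand-Yaglom-Perez) as the
   supremum over finite measurable partitions of
   sum_{i,j} P_XY(A_i x B_j) ln (P_XY(A_i x B_j) / (P_X(A_i) P_Y(B_j))). *)
Definition finite_mutual_info (PX : probability R R) (K : R.-pker R ~> R) : Prop :=
  exists M : R, forall (m k : nat) (A : 'I_m -> set R) (B : 'I_k -> set R),
    meas_partition A -> meas_partition B ->
    \sum_(i < m) \sum_(j < k)
       (joint_rect PX K (A i) (B j) *
        ln (joint_rect PX K (A i) (B j) /
            (fine (PX (A i)) * out_prob PX K (B j)))) <= M.

Definition input_channel_pair (PX : probability R R) (K : R.-pker R ~> R) : Prop :=
  finite_mutual_info PX K.

Definition uniform01 {d} {T : measurableType d} (P : probability T R)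
  (U : T -> R) : Prop :=
  forall A : set R, measurable A ->
    P (U @^-1` A) = lebesgue_measure (A `&` [set` `]0, 1[]).

Definition has_law {d} {T : measurableType d} (P : probability T R)
  (X : T -> R) (mu : probability R R) : Prop :=
  forall A : set R, measurable A -> P (X @^-1` A) = mu A.

Definition indep_rv {d d1 d2} {T : measurableType d} {T1 : measurableType d1}
  {T2 : measurableType d2} (P : probability T R) (X : T -> T1) (Y : T -> T2) : Prop :=
  forall (A : set T1) (B : set T2), measurable A -> measurable B ->
    P (X @^-1` A `&` Y @^-1` B) = (P (X @^-1` A) * P (Y @^-1` B))%E.

(* the output vector Y^n = (Y_1, ..., Y_n); Y i stands for Y_{i+1} *)
Definition outs {T : Type} (Y : nat -> T -> R) (n : nat) (w : T) : n.-tuple R :=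
  [tuple Y (nat_of_ord i) w | i < n].

(* F : R -> n.-tuple R -> R is (a version of) the posterior c.d.f.
   F_{Theta0|Y^n}(theta | y^n) : a regular conditional c.d.f. of Theta0 given Y^n *)
Definition posterior_cdf {d} {T : measurableType d} (P : probability T R)
  (Theta0 : T -> R) (Y : nat -> T -> R) (n : nat) (F : R -> n.-tuple R -> R) : Prop :=
  measurable_fun setT (fun p : R * n.-tuple R => F p.1 p.2) /\
  (forall y : n.-tuple R, {homo F ^~ y : s t / s <= t} /\
     (forall t, F x y @[x --> t^'+] --> F t y) /\
     F x y @[x --> -oo] --> (0:R) /\
     F x y @[x --> +oo] --> (1:R)) /\
  (forall (t : R) (B : set (n.-tuple R)), measurable B ->
     P ([set w | Theta0 w <= t] `&` outs Y n @^-1` B) =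
     (\int[P]_(w in outs Y n @^-1` B) (F t (outs Y n w))%:E)%E).

End defs.

(* Main.v *)
Require Import Defs.
From HB Require Import structures.
From mathcomp Require Import all_boot all_order all_algebra.
From mathcomp Require Import all_classical all_reals all_analysis.
From mathcomp Require Import measurable_realfun.
From mathcomp Require Import ring lra.
Set Implicit Arguments. Unset Strict Implicit. Unset Printing Implicit Defensive.
Import Order.TTheory GRing.Theory Num.Theory.
Import numFieldNormedType.Exports.
Local Open Scope classical_set_scope.
Local Open Scope ring_scope.

(* The posterior of [Theta0] given [Y^n] must be shown to be atomless; then
   [U_n] is its probability integral transform, hence uniform and independent of
   [Y^n], and [Theta0] is a posterior quantile of [U_n].

   Atomlessness goes by induction on [n], in the form: a measurable set whose
   sections at every [y^n] are null for the law of [Theta0] is null for the law of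
   [(Theta0, Y^n)].  The first [n] steps give [X_{n+1} ~ P_X], so the mutual
   information of [X_{n+1}] and [Y_{n+1}] is finite.  This bounds, for every
   finite quantization of [Y_{n+1}], the mass on which the likelihood ratio
   exceeds [e^(1+t)] by [M / t]; conditioning on [Z = (Theta0, Y^n)], of which
   [X_{n+1}] is a function, the joint law of [(Z, Y_{n+1})] is at most
   [e^(1+t)] times the product of its marginals plus [M / t] on finite unions of
   rectangles.  These approximate every measurable set, so the joint law is
   absolutely continuous with respect to the product, which is the induction step. *)

Lemma ereal_le0_of_pos (R : realType) (x : \bar R) :
  (forall e : R, 0 < e -> (x <= e%:E)%E) -> (x <= 0)%E.
Proof. by move=> h; apply/lee_addgt0Pr => e e0; rewrite add0e h. Qed.

(** * Approximation of measurable sets by finite unions of rectangles *)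

Section finite_rectangles.
Context d1 d2 (T1 : measurableType d1) (T2 : measurableType d2) (R : realType).

(** A finite union of rectangles, encoded by a finite quantization [b] of the second coordinate: the
    pieces are disjoint by construction, and [b] can serve directly as a quantizer of the channel
    output. *)
Definition blocks (I : finType) (A : I -> set T1) (b : T2 -> I) : set (T1 * T2) :=
  [set p | A (b p.2) p.1].

Definition finite_rectangles : set (set (T1 * T2)) :=
  [set D | exists (I : finType) (A : I -> set T1) (b : T2 -> I),
     [/\ forall i, measurable (A i), forall i, measurable (b @^-1` [set i]) &
         D = blocks A b]].

Lemma blocksE (I : finType) (A : I -> set T1) (b : T2 -> I) :
  blocks A b = \bigcup_(i in [set: I]) (A i `*` b @^-1` [set i]).
Proof.
apply/seteqP; split => [[x y] /= Axy|[x y] [i _ [/= Ai byi]]].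
  by exists (b y).
by rewrite /blocks /= byi.
Qed.

Lemma measurable_finite_rectangles D : finite_rectangles D -> measurable D.
Proof.
move=> [I [A [b [mA mb ->]]]]; rewrite blocksE.
by apply: fin_bigcup_measurable => // i _; exact: measurableX.
Qed.

Lemma measure_blocks (m : {measure set (T1 * T2) -> \bar R}) (I : finType)
    (A : I -> set T1) (b : T2 -> I) :
  (forall i, measurable (A i)) -> (forall i, measurable (b @^-1` [set i])) ->
  m (blocks A b) = (\sum_i m (A i `*` b @^-1` [set i]))%E.
Proof.
move=> mA mb.
have -> : blocks A b = \bigcup_(i in [set` index_enum I]) (A i `*` b @^-1` [set i]).
  rewrite blocksE; congr bigcup; apply/seteqP; split=> i //= _.
  exact: mem_index_enum.
rewrite measure_fin_bigcup.
- by rewrite -fsbig_seq// index_enum_uniq.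
- exact: finite_seq.
- by move=> i j _ _ [[x y] [[_ /= <-] [_ /= <-]]].
- by move=> i _; exact: measurableX.
Qed.

Lemma finite_rectanglesX (A : set T1) (B : set T2) :
  measurable A -> measurable B -> finite_rectangles (A `*` B).
Proof.
move=> mA mB; exists bool, (fun i => if i then A else set0), (fun y => y \in B).
split=> [[]//|i|].
- case: i.
  + suff -> : (fun y => y \in B) @^-1` [set true] = B by [].
    by apply/seteqP; split => y /= => [/set_mem|/mem_set].
  + suff -> : (fun y => y \in B) @^-1` [set false] = ~` B by exact: measurableC.
    by apply/seteqP; split => y /=; [move=> + By; rewrite mem_set|exact: memNset].
- apply/seteqP; split => [[x y] /= [Ax By]|[x y]]; rewrite /blocks/=.
    by rewrite mem_set.
  by case: ifPn => // /set_mem.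
Qed.

(** Pairing the two quantizers gives a common refinement, on each fibre of which the difference acts
    on first coordinates only. *)
Lemma finite_rectanglesD D D' :
  finite_rectangles D -> finite_rectangles D' -> finite_rectangles (D `\` D').
Proof.
move=> [I [A [b [mA mb ->]]]] [I' [A' [b' [mA' mb' ->]]]].
exists (I * I')%type, (fun i => A i.1 `\` A' i.2), (fun y => (b y, b' y)); split.
- by move=> i; exact: measurableD.
- move=> [i i']; rewrite (_ : _ @^-1` _ = b @^-1` [set i] `&` b' @^-1` [set i']).
    exact: measurableI.
  by apply/seteqP; split => y /=; [case=> -> ->|case=> -> ->].
- by [].
Qed.

Local Open Scope ereal_scope.

(** A Dynkin argument: the sets approximable for every [e] form a lambda-system containing the
    rectangles, which are stable under intersection. One [D] serves both measures, so that the joint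
    law and the product of its marginals can later be compared on it. *)
Lemma finite_rectangles_approx (m1 m2 : {measure set (T1 * T2) -> \bar R})
    (C : set (T1 * T2)) (e : R) :
  m1 setT < +oo -> m2 setT < +oo -> measurable C -> (0 < e)%R ->
  exists2 D, finite_rectangles D & m1 (C `+` D) <= e%:E /\ m2 (C `+` D) <= e%:E.
Proof.
move=> m1T m2T mC e0.
pose G := [set A `*` B | A in @measurable _ T1 & B in @measurable _ T2].
pose H := [set C | measurable C /\ forall e : R, (0 < e)%R ->
  exists2 D, finite_rectangles D & m1 (C `+` D) <= e%:E /\ m2 (C `+` D) <= e%:E].
suff /(_ C) : measurable `<=` H by move=> /(_ mC)[_]; exact.
rewrite measurable_prod_measurableType.
have mY : forall A D : set (T1 * T2), measurable A -> finite_rectangles D -> measurable (A `+` D).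
  move=> A D mA /measurable_finite_rectangles mD.
  by apply: measurableU; exact: measurableD.
apply: lambda_system_subset => //.
- move=> X Y [X1 mX1 [X2 mX2 <-]] [Y1 mY1 [Y2 mY2 <-]].
  exists (X1 `&` Y1); first exact: measurableI.
  by exists (X2 `&` Y2); [exact: measurableI|rewrite setXI].
- split => //.
  + split=> // {}e {}e0; exists setT; last by rewrite setYK !measure0 lee_fin ltW.
    by rewrite -setXTT; exact: finite_rectanglesX.
  + move=> A B BA [mA HA] [mB HB]; split; first exact: measurableD.
    move=> {}e {}e0; have e20 : (0 < e / 2)%R by rewrite divr_gt0.
    have [DA rDA [A1 A2]] := HA _ e20; have [DB rDB [B1 B2]] := HB _ e20.
    exists (DA `\` DB); first exact: finite_rectanglesD.
    (* The error of a difference is covered by the errors of the two sets, hence the halves of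
       [e]. *)
    have sub : (A `\` B) `+` (DA `\` DB) `<=` (A `+` DA) `|` (B `+` DB).
      move=> x; rewrite /setY /=.
      have [?|?] := pselect (A x); have [?|?] := pselect (B x);
      have [?|?] := pselect (DA x); have [?|?] := pselect (DB x); tauto.
    have mAB : measurable ((A `\` B) `+` (DA `\` DB)).
      by apply: mY; [exact: measurableD|exact: finite_rectanglesD].
    rewrite (splitr e) EFinD; split.
    * apply: (le_trans (le_measure m1 _ _ sub)); rewrite ?inE//.
        by apply: measurableU; exact: mY.
      by apply: (le_trans (measureU2 _ _ _)); [exact: mY|exact: mY|exact: leeD].
    * apply: (le_trans (le_measure m2 _ _ sub)); rewrite ?inE//.
        by apply: measurableU; exact: mY.
      by apply: (le_trans (measureU2 _ _ _)); [exact: mY|exact: mY|exact: leeD].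
  + move=> A ndA HA; have mA n : measurable (A n) by have [] := HA n.
    have mUA : measurable (\bigcup_n A n) by exact: bigcupT_measurable.
    split=> // {}e {}e0; have e20 : (0 < e / 2)%R by rewrite divr_gt0.
    (* Finiteness gives continuity from above: what the increasing union adds to [A n] tends to
       zero, so one [A N] close to the union for both measures may be approximated instead. *)
    have tail (m : {measure set (T1 * T2) -> \bar R}) : m setT < +oo ->
        \forall n \near \oo, m (\bigcup_n A n `\` A n) < (e / 2)%:E.
      move=> mT.
      have : m (\bigcup_n A n `\` A n) @[n --> \oo] --> m (\bigcap_n (\bigcup_n A n `\` A n)).
        apply: nonincreasing_cvg_mu.
        - by apply: le_lt_trans mT; apply: le_measure; rewrite ?inE//; exact: measurableD.
        - by move=> n; exact: measurableD.
        - by apply: bigcapT_measurable => n; exact: measurableD.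
        - by move=> i j ij; apply/subsetPset; apply: setDS; apply/subsetPset/ndA.
      have -> : \bigcap_n (\bigcup_n A n `\` A n) = set0.
        by rewrite -subset0 => x Ax; have [[n _ Anx] _] := Ax 0%N I; have [_] := Ax n I.
      rewrite measure0 => /(_ [set y | y < (e / 2)%:E]); apply.
      by apply: open_ereal_lt'; rewrite lte_fin.
    have := filterI (tail m1 m1T) (tail m2 m2T) => -[N _ /(_ N (leqnn N))/= [t1 t2]].
    have [D rD [D1 D2]] := (HA N).2 _ e20.
    exists D => //.
    have sub : (\bigcup_n A n) `+` D `<=` (\bigcup_n A n `\` A N) `|` (A N `+` D).
      move=> x; have AU : A N x -> (\bigcup_n A n) x by exists N.
      rewrite /setY /=.
      by have [?|?] := pselect (A N x); have [?|?] := pselect (D x); tauto.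
    have mUD : measurable (\bigcup_n A n `\` A N) by exact: measurableD.
    rewrite (splitr e) EFinD; split.
    * apply: (le_trans (le_measure m1 _ _ sub)); rewrite ?inE//; first exact: mY.
        by apply: measurableU => //; exact: mY.
      by apply: (le_trans (measureU2 _ _ _)) => //; [exact: mY|apply: leeD => //; exact: ltW].
    * apply: (le_trans (le_measure m2 _ _ sub)); rewrite ?inE//; first exact: mY.
        by apply: measurableU => //; exact: mY.
      by apply: (le_trans (measureU2 _ _ _)) => //; [exact: mY|apply: leeD => //; exact: ltW].
- move=> _ [A mA [B mB <-]]; split; first exact: measurableX.
  move=> {}e {}e0; exists (A `*` B); first exact: finite_rectanglesX.
  by rewrite setYK !measure0 lee_fin ltW.
Qed.
End finite_rectangles.

Lemma measurable_preim {d d'} {T : measurableType d} {T' : measurableType d'}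
  (f : T -> T') (A : set T') : measurable_fun setT f -> measurable A ->
  measurable (f @^-1` A).
Proof. by move=> mf mA; rewrite -[X in measurable X]setTI; exact: mf. Qed.

(** * Information and absolute continuity *)

(** This is [ln x <= 1 * x - 1] at [x = q / p], multiplied by [p]; the case [p = 0] is trivial. *)
Lemma mulr_ln_ge_sub (R : realType) (p q : R) :
  0 <= p -> 0 <= q -> (q = 0 -> p = 0) -> p - q <= p * ln (p / q).
Proof.
rewrite le_eqVlt => /predU1P[<- q0 _|p0 q0 qp]; first by rewrite mul0r subr_le0.
have {}q0 : 0 < q.
  by rewrite lt_neqAle q0 andbT; apply: contraPneq p0 => /esym/qp ->; rewrite ltxx.
have qp0 : 0 < q / p by rewrite divr_gt0.
have -> : ln (p / q) = - ln (q / p) by rewrite -lnV ?posrE// invf_div.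
have : ln (q / p) <= q / p - 1.
  have -> : ln (q / p) = ln (1 + (q / p - 1)) by rewrite addrC subrK.
  by apply: le_ln1Dx; rewrite ltrBrDl subrr.
rewrite -(ler_pM2l p0) mulrBr mulrCA divff ?gt_eqF// !mulr1 mulrN.
by move=> ?; rewrite lerNr opprB.
Qed.

(** The logarithm is at least [1 + t]: the [1] pays for the subtracted [p], and [q] is only a
    gain. *)
Lemma mulr_ln_ge_excess (R : realType) (p q t : R) :
  0 <= p -> 0 <= q -> (q = 0 -> p = 0) -> expR (1 + t) * q <= p ->
  p * t <= p * ln (p / q) - (p - q).
Proof.
rewrite le_eqVlt => /predU1P[<- q0 _ _|p0 q0 qp cqp].
  by rewrite !mul0r sub0r opprB subr0.
have {}q0 : 0 < q.
  by rewrite lt_neqAle q0 andbT; apply: contraPneq p0 => /esym/qp ->; rewrite ltxx.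
have : 1 + t <= ln (p / q).
  by rewrite -[leLHS]expRK ler_ln ?posrE ?expR_gt0 ?divr_gt0// ler_pdivlMr.
rewrite -(ler_pM2l p0) mulrDr mulr1 => h.
by rewrite lerBrDr (le_trans _ h)// addrC; lra.
Qed.

Section prob.
Context d (T : measurableType d) (R : realType) (P : probability T R).

Definition pr (A : set T) : R := fine (P A).

Lemma prE A : measurable A -> P A = (pr A)%:E.
Proof. by move=> mA; rewrite /pr fineK// fin_num_measure. Qed.

Lemma pr_ge0 A : 0 <= pr A. Proof. exact: fine_ge0. Qed.

Lemma le_pr A B : measurable A -> measurable B -> A `<=` B -> pr A <= pr B.
Proof. by move=> mA mB AB; rewrite -lee_fin -!prE// le_measure ?inE. Qed.

Lemma pr_fibers (J : finType) (f : T -> J) A : measurable A ->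
  (forall j, measurable (f @^-1` [set j])) ->
  pr A = \sum_j pr (A `&` f @^-1` [set j]).
Proof.
move=> mA mf; apply: EFin_inj; rewrite -sumEFin -prE//.
have E j : (pr (A `&` f @^-1` [set j]))%:E = P (A `&` f @^-1` [set j]).
  by rewrite prE//; exact: measurableI.
rewrite (eq_bigr _ (fun j _ => E j)) [in LHS](_ : A = \bigcup_(j in [set` index_enum J]) (A `&` f @^-1` [set j])).
  rewrite measure_fin_bigcup.
  - by rewrite -fsbig_seq// index_enum_uniq.
  - exact: finite_seq.
  - by move=> i j _ _ [x [[_ /= <-] [_ /= <-]]].
  - by move=> j _; exact: measurableI.
apply/seteqP; split=> [x Ax|x [j _ []]//].
by exists (f x) => //=; rewrite mem_index_enum.
Qed.

End prob.

(** The bound of [finite_mutual_info] for random variables on the sample space, with no reference to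
    an input law or a kernel. *)
Definition information_le {d} {T : measurableType d} {R : realType}
    (P : probability T R) (X Y : T -> R) (M : R) : Prop :=
  forall (m k : nat) (A : 'I_m -> set R) (B : 'I_k -> set R),
    meas_partition A -> meas_partition B ->
    \sum_(i < m) \sum_(j < k)
       (pr P (X @^-1` A i `&` Y @^-1` B j) *
        ln (pr P (X @^-1` A i `&` Y @^-1` B j) /
            (pr P (X @^-1` A i) * pr P (Y @^-1` B j)))) <= M.

Section information.
Context d (T : measurableType d) (R : realType) (P : probability T R).
Variables (X Y : T -> R) (M : R).
Hypotheses (mX : measurable_fun setT X) (mY : measurable_fun setT Y).
Hypothesis XYM : information_le P X Y M.

Lemma meas_partition_fibers (J : finType) (a : R -> J) :
  (forall j, measurable (a @^-1` [set j])) ->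
  meas_partition (fun i : 'I_#|J| => a @^-1` [set enum_val i]).
Proof.
move=> ma; split=> [//|]; split=> [i j|x].
  move=> ij; rewrite -subset0 => x [/= -> /enum_val_inj ji].
  by rewrite ji eqxx in ij.
by exists (enum_rank (a x)); rewrite /= enum_rankK.
Qed.

(** Reindexing by [enum_val] frees the partitions from ordinals; the cells used below are indexed by
    finite functions from [I] to [bool]. *)
Lemma information_le_fin (J I : finType) (a : R -> J) (b : R -> I) :
  (forall j, measurable (a @^-1` [set j])) ->
  (forall i, measurable (b @^-1` [set i])) ->
  let p j i := pr P (X @^-1` (a @^-1` [set j]) `&` Y @^-1` (b @^-1` [set i])) in
  let q j i := pr P (X @^-1` (a @^-1` [set j])) * pr P (Y @^-1` (b @^-1` [set i])) in
  (\sum_j \sum_i (p j i * ln (p j i / q j i)) <= M : Prop).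
Proof.
move=> ma mb p q.
suff -> : \sum_j \sum_i (p j i * ln (p j i / q j i)) = \sum_(k < #|J|) \sum_(l < #|I|)
    (p (enum_val k) (enum_val l) * ln (p (enum_val k) (enum_val l) /
                                       q (enum_val k) (enum_val l))).
  exact: (XYM (meas_partition_fibers ma) (meas_partition_fibers mb)).
rewrite (big_enum_val (A := predT)) /=; apply: eq_bigr => k _.
by rewrite (big_enum_val (A := predT)).
Qed.

(* Cut the range of [X] along all the [E i]: then [p ln (p / q) - (p - q)] is
   nonnegative on every cell, and at least [p t] on the cells inside [E i]. *)
Lemma information_excess (I : finType) (b : R -> I) (E : I -> set R) (t : R) :
  0 <= t -> (forall i, measurable (b @^-1` [set i])) ->
  (forall i, measurable (E i)) ->
  (forall i A, measurable A -> A `<=` E i ->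
    expR (1 + t) * (pr P (X @^-1` A) * pr P (Y @^-1` (b @^-1` [set i]))) <=
    pr P (X @^-1` A `&` Y @^-1` (b @^-1` [set i]))) ->
  (\sum_i pr P (X @^-1` E i `&` Y @^-1` (b @^-1` [set i]))) * t <= M.
Proof.
move=> t0 mb mE EP.
pose a x : {ffun I -> bool} := [ffun i => x \in E i].
have ma v : measurable (a @^-1` [set v]).
  have -> : a @^-1` [set v] = \bigcap_(i in [set: I]) (if v i then E i else ~` E i).
    apply/seteqP; split=> [x /= <- i _|x /= vx].
      rewrite ffunE; have [/set_mem//|xE] := boolP (x \in E i).
      by move: xE; rewrite notin_setE.
    apply/ffunP => i; rewrite ffunE; have := vx i Logic.I.
    by case: (v i) => vi; [exact: mem_set|exact: memNset].
  by apply: fin_bigcap_measurable => // i _; case: ifP => // _; exact: measurableC.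
pose p v i := pr P (X @^-1` (a @^-1` [set v]) `&` Y @^-1` (b @^-1` [set i])).
pose q v i := pr P (X @^-1` (a @^-1` [set v])) * pr P (Y @^-1` (b @^-1` [set i])).
have mXa v : measurable (X @^-1` (a @^-1` [set v])) by exact: measurable_preim.
have mYb i : measurable (Y @^-1` (b @^-1` [set i])) by exact: measurable_preim.
have p0 v i : 0 <= p v i by exact: pr_ge0.
have q0 v i : 0 <= q v i by rewrite mulr_ge0 ?pr_ge0.
(* A null marginal forces a null joint cell, as both inequalities on [ln] require. *)
have qp v i : q v i = 0 -> p v i = 0.
  move=> /eqP; rewrite mulf_eq0 => qvi; apply/eqP; rewrite eq_le p0 andbT.
  by case/orP: qvi => /eqP <-; apply: le_pr => //; exact: measurableI.
have prT : pr P setT = 1 by rewrite /pr probability_setT.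
have sum_fib (J : finType) (f : T -> J) : (forall j, measurable (f @^-1` [set j])) ->
    \sum_j pr P (f @^-1` [set j]) = 1.
  move=> mf; rewrite -prT (pr_fibers P measurableT mf).
  by apply: eq_bigr => j _; rewrite setTI.
have sp : \sum_v \sum_i p v i = 1.
  rewrite -(sum_fib _ (a \o X))//; apply: eq_bigr => v _.
  by rewrite (pr_fibers P (mXa v) (f := b \o Y)).
have sq : \sum_v \sum_i q v i = 1.
  under eq_bigr do rewrite -mulr_sumr (sum_fib _ (b \o Y))// mulr1.
  exact: (sum_fib _ (a \o X)).
have -> : \sum_i pr P (X @^-1` E i `&` Y @^-1` (b @^-1` [set i])) =
    \sum_(v : {ffun I -> bool}) \sum_i (v i)%:R * p v i.
  rewrite exchange_big; apply: eq_bigr => i _.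
  rewrite (pr_fibers P (f := a \o X))//; last by apply: measurableI => //; exact: measurable_preim.
  apply: eq_bigr => v _; case: (boolP (v i)) => vi.
    rewrite mul1r /p; congr pr; apply/seteqP; split=> x /=.
      by move=> [[_ ?] ?].
    move=> [av ?]; split=> //; split=> //.
    by move: vi; rewrite -av ffunE => /set_mem.
  rewrite mul0r; have -> : X @^-1` E i `&` Y @^-1` (b @^-1` [set i]) `&` (a \o X) @^-1` [set v] = set0.
    rewrite -subset0 => x /= [[Ei _] av]; move: vi.
    by rewrite -av ffunE mem_set.
  by rewrite /pr measure0.
rewrite (le_trans _ (information_le_fin ma mb))//.
(* Both [p] and [q] sum to [1], so subtracting [p - q] in every cell leaves the total unchanged. *)
have -> : \sum_v \sum_i p v i * ln (p v i / q v i) =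
    \sum_v \sum_i (p v i * ln (p v i / q v i) - (p v i - q v i)).
  by do 2 (under [RHS]eq_bigr do rewrite sumrB); rewrite !sumrB sp sq subrr subr0.
rewrite mulr_suml; apply: ler_sum => v _; rewrite mulr_suml; apply: ler_sum => i _.
case: (boolP (v i)) => vi; last first.
  by rewrite !mul0r subr_ge0 mulr_ln_ge_sub//; exact: qp.
rewrite mul1r; apply: mulr_ln_ge_excess => //; first exact: qp.
by apply: EP => // x /= av; move: vi; rewrite -av ffunE => /set_mem.
Qed.

End information.

(** * Null sets of the joint law of a channel *)

Section channel.
Context d d' (T : measurableType d) (S : measurableType d') (R : realType).
Variables (P : probability T R) (K : R.-pker R ~> R).
Variables (Z : {mfun T >-> S}) (phi : {mfun S >-> R}) (Y : {mfun T >-> R}) (M : R).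
Hypothesis channel : forall (A : set S) (B : set R), measurable A -> measurable B ->
  P (Z @^-1` A `&` Y @^-1` B) = (\int[P]_(w in Z @^-1` A) K (phi (Z w)) B)%E.
Hypothesis info : information_le P (phi \o Z) Y M.

(** Each [A i] is split according to whether the conditional probability of the [i]-th output cell
    reaches [expR (1 + t)] times its unconditional one. Where it does not, the channel formula gives
    the product bound; where it does, [information_excess] bounds all [i] together by [M / t]. *)
Lemma channel_blocks_le (I : finType) (A : I -> set S) (b : R -> I) (t : R) :
  0 < t -> (forall i, measurable (A i)) ->
  (forall i, measurable (b @^-1` [set i])) ->
  \sum_i pr P (Z @^-1` A i `&` Y @^-1` (b @^-1` [set i])) <=
  expR (1 + t) * \sum_i (pr P (Z @^-1` A i) * pr P (Y @^-1` (b @^-1` [set i]))) + M / t.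
Proof.
move=> t0 mA mb; set c := expR (1 + t).
have c0 : 0 < c by exact: expR_gt0.
pose B i := b @^-1` [set i].
pose E i : set R := [set x | ((c * pr P (Y @^-1` B i))%:E <= K x (B i))%E].
have mE i : measurable (E i).
  rewrite /E -preimage_itvcy; apply: measurable_preim (emeasurable_itv _).
  exact: (measurable_kernel K _ (mb i)).
have mZ A' : measurable A' -> measurable (Z @^-1` A').
  by move=> ?; apply: measurable_preim.
have mY A' : measurable A' -> measurable (Y @^-1` A').
  by move=> ?; apply: measurable_preim.
have mphi A' : measurable A' -> measurable (phi @^-1` A').
  by move=> ?; apply: measurable_preim.
have mX A' : measurable A' -> measurable ((phi \o Z) @^-1` A').
  by move=> mA'; exact: (mZ _ (mphi _ mA')).
have mK i : measurable_fun setT (fun w => K (phi (Z w)) (B i)).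
  apply: (measurableT_comp (f := fun x => K x (B i))); first exact: (measurable_kernel K _ (mb i)).
  exact: measurableT_comp.
have excess : (\sum_i pr P ((phi \o Z) @^-1` E i `&` Y @^-1` B i)) <= M / t.
  rewrite ler_pdivlMr//; apply: (information_excess _ _ info) => //.
  - exact: ltW.
  (* Integrating the pointwise bound that defines [E i] over [A'] gives the ratio condition of
     [information_excess]. *)
  - move=> i A' mA' A'E; rewrite -lee_fin.
    rewrite -[leRHS]prE; last by apply: measurableI; [exact: mX|exact: (mY _ (mb i))].
    rewrite comp_preimage channel//; last exact: mphi.
    rewrite mulrCA mulrC EFinM -prE; last exact: mX.
    rewrite -integral_cst; last exact: mX.
    apply: ge0_le_integral => //.
    + exact: mX.
    + by move=> w _; rewrite lee_fin mulr_ge0 ?pr_ge0// ltW.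
    + exact: measurable_funS (mK i).
    + by move=> w /= /A'E.
rewrite mulr_sumr (le_trans _ (lerD (lexx _) excess))// -big_split/=.
apply: ler_sum => i _.
have mAE : measurable (Z @^-1` (A i `\` phi @^-1` E i)).
  by apply/mZ/measurableD => //; exact: mphi.
have mAEY : measurable (Z @^-1` (A i `\` phi @^-1` E i) `&` Y @^-1` B i).
  by apply: measurableI => //; exact: (mY _ (mb i)).
have mEY : measurable ((phi \o Z) @^-1` E i `&` Y @^-1` B i).
  by apply: measurableI; [exact: (mX _ (mE i))|exact: (mY _ (mb i))].
(* On [E i] the constraint [A i] is dropped, as the excess bound does not involve it. *)
apply: (@le_trans _ _ (pr P (Z @^-1` (A i `\` phi @^-1` E i) `&` Y @^-1` B i) +
    pr P ((phi \o Z) @^-1` E i `&` Y @^-1` B i))).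
  rewrite -lee_fin EFinD -!prE//; last by apply: measurableI; [exact: mZ|exact: (mY _ (mb i))].
  apply: le_trans (measureU2 _ mAEY mEY); apply: le_measure; rewrite ?inE.
  - by apply: measurableI; [exact: mZ|exact: (mY _ (mb i))].
  - exact: measurableU.
  - move=> w /= [Aw Bw]; have [Ew|Ew] := pselect (E i (phi (Z w))); by [right|left].
rewrite lerD2r -lee_fin -prE// channel//; last 2 first.
- by apply: measurableD => //; exact: mphi.
- exact: mb.
apply: (@le_trans _ _ (\int[P]_(w in Z @^-1` (A i `\` phi @^-1` E i))
   cst (c * pr P (Y @^-1` B i))%:E w)%E).
  apply: ge0_le_integral => //; first exact: measurable_funS (mK i).
  by move=> w /= [_ /negP]; rewrite -ltNge => /ltW.
rewrite (integral_cst P mAE).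
rewrite [X in (_ * X)%E](_ : _ = (pr P (Z @^-1` (A i `\` phi @^-1` E i)))%:E); last exact: prE.
rewrite -EFinM lee_fin -mulrA (ler_wpM2l (ltW c0))// mulrC (ler_wpM2r (pr_ge0 _ _))//.
by apply: le_pr => //; [exact: mZ|move=> w []].
Qed.

(** [C] is replaced by a finite union of rectangles [D] close to it for both laws. The product law
    gives [C] mass zero by Fubini, so [D] has small product mass, and the block bound carries this
    over to the joint law. *)
Lemma channel_joint_negligible (C : set (S * R)) : measurable C ->
  (forall y, P (Z @^-1` ysection C y) = 0%E) ->
  P ((fun w => (Z w, Y w)) @^-1` C) = 0%E.
Proof.
move=> mC C0.
have mZY : measurable_fun setT (fun w => (Z w, Y w)) by exact: measurable_fun_pair.
pose ZY : {mfun T >-> (S * R)%type} := HB.pack (fun w => (Z w, Y w))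
  (isMeasurableFun.Build _ _ _ _ _ mZY).
pose m1 := distribution P ZY.
(* [\x^] integrates over [y] the masses of the sections at [y], the form in which the hypothesis on
   [C] is given. *)
pose m2 := (distribution P Z \x^ distribution P Y)%E.
have m1T : (m1 setT < +oo)%E.
  by rewrite /m1 /distribution /pushforward preimage_setT probability_setT ltry.
have m2T : (m2 setT < +oo)%E.
  by rewrite -setXTT /m2 product_measure2E//= !probability_setT mule1 ltry.
have m2C : m2 C = 0%E.
  by rewrite /m2 /product_measure2 integral0_eq// => y _; exact: C0.
apply/eqP; rewrite eq_le measure_ge0 andbT; apply: ereal_le0_of_pos => e e0.
(* First [t] makes [M / t] at most [e / 2], the absolute value and the [1] keeping it positive
   whatever the sign of [M]. This fixes [c], and [h] is then chosen with [c * h + h = e / 2]. *)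
pose t := 2 * (`|M| + 1) / e.
have t0 : 0 < t by rewrite divr_gt0// mulr_gt0// ltr_wpDl.
have Mt : M / t <= e / 2.
  rewrite ler_pdivrMr// /t; have -> : e / 2 * (2 * (`|M| + 1) / e) = `|M| + 1.
    by field; rewrite gt_eqF.
  by rewrite (le_trans (ler_norm _))// lerDl.
set c := expR (1 + t); have c0 : 0 < c by exact: expR_gt0.
pose h := e / 2 / (c + 1).
have h0 : 0 < h by rewrite !divr_gt0// addr_gt0.
have [D [I [A [b [mA mb DE]]]] [D1 D2]] : exists2 D, finite_rectangles D &
    (m1 (C `+` D) <= h%:E /\ m2 (C `+` D) <= h%:E)%E.
  exact: finite_rectangles_approx.
have mD : measurable D by apply: measurable_finite_rectangles; exists I, A, b.
have mCD : measurable (C `+` D) by apply: measurableU; exact: measurableD.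
have sub (m : {measure set (S * R) -> \bar R}) (U V : set (S * R)) :
    measurable U -> measurable V -> (m U <= m V + m (U `+` V))%E.
  move=> mU mV; apply: le_trans (measureU2 _ _ _) => //; last first.
    by apply: measurableU; exact: measurableD.
  apply: le_measure; rewrite ?inE//.
    by apply: measurableU => //; apply: measurableU; exact: measurableD.
  by move=> x Ux; have [?|?] := pselect (V x); [left|right; left].
have m1D : m1 D = (\sum_i pr P (Z @^-1` A i `&` Y @^-1` (b @^-1` [set i])))%:E.
  rewrite DE /m1 measure_blocks// -sumEFin; apply: eq_bigr => i _.
  rewrite -prE//; apply: measurableI; exact: measurable_preim.
have m2D : m2 D = (\sum_i (pr P (Z @^-1` A i) * pr P (Y @^-1` (b @^-1` [set i]))))%:E.
  rewrite DE /m2 measure_blocks// -sumEFin; apply: eq_bigr => i _.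
  by rewrite [LHS](product_measure2E _ _ (mA i) (mb i)) EFinM -!prE//; exact: measurable_preim.
have m2Dh : (m2 D <= h%:E)%E.
  have := sub (distribution P Z \x^ distribution P Y)%E D C mD mC.
  move=> /le_trans; apply; rewrite setYC -[h%:E]add0e.
  have m2C0 : (m2 C <= 0)%E by rewrite m2C.
  by apply: leeD; [exact: m2C0|exact: D2].
have m1Dh : (m1 D <= (c * h + M / t)%:E)%E.
  rewrite m1D lee_fin; apply: le_trans (channel_blocks_le t0 mA mb) _.
  by rewrite lerD2r ler_wpM2l ?(ltW c0)// -lee_fin -m2D.
apply: (@le_trans _ _ ((c * h + M / t)%:E + h%:E)%E).
  apply: (le_trans (sub (distribution P ZY) C D mC mD)).
  by apply: leeD; [exact: m1Dh|exact: D1].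
rewrite -EFinD lee_fin addrAC [leRHS]splitr.
apply: lerD => //; rewrite -{2}[h]mul1r -mulrDl /h mulrC divfK// gt_eqF// addr_gt0//.
Qed.

End channel.

(** * Probability integral transform of a posterior distribution *)

Section measurable_comparison.
Context d (T : measurableType d) (R : realType).
Implicit Types f g : T -> R.

Lemma measurable_set_lt f g : measurable_fun setT f -> measurable_fun setT g ->
  measurable [set w | f w < g w].
Proof.
move=> mf mg; rewrite (_ : [set _ | _] = (fun w => f w < g w) @^-1` [set true])//.
by apply: measurable_preim => //; exact: measurable_fun_ltr.
Qed.

Lemma measurable_set_le f g : measurable_fun setT f -> measurable_fun setT g ->
  measurable [set w | f w <= g w].
Proof.
move=> mf mg; rewrite (_ : [set _ | _] = (fun w => f w <= g w) @^-1` [set true])//.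
by apply: measurable_preim => //; exact: measurable_fun_ler.
Qed.

Lemma measurable_set_eq f g : measurable_fun setT f -> measurable_fun setT g ->
  measurable [set w | f w = g w].
Proof.
move=> mf mg.
rewrite (_ : [set _ | _] = [set w | f w <= g w] `&` [set w | g w <= f w]).
  by apply: measurableI; exact: measurable_set_le.
apply/seteqP; split=> w /=; first by move=> ->.
by move=> [fg gf]; apply/eqP; rewrite eq_le fg.
Qed.

Lemma measurable_fun_gt_set f : (forall x, measurable [set w | x < f w]) ->
  measurable_fun setT f.
Proof.
move=> mf; apply: (measurability _ (RGenOInfty.measurableE R)) => // _ [_ [x ->] <-].
rewrite setTI (_ : _ @^-1` _ = [set w | x < f w])//.
by apply/seteqP; split=> w /=; rewrite in_itv/= andbT.
Qed.

End measurable_comparison.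

(** Open half-lines form a generating pi-system, and countably many of them cover the line, so
    uniqueness of measures applies. *)
Lemma eq_measure_half_lines (R : realType) (m1 m2 : {measure set R -> \bar R}) :
  (m1 setT < +oo)%E -> (forall x, m1 [set` `]-oo, x[] = m2 [set` `]-oo, x[]) ->
  forall A, measurable A -> m1 A = m2 A.
Proof.
move=> m1T m12 A mA.
apply: (measure_unique (@RGenInftyO.G R) (fun n => [set` `]-oo, n%:R[])) => //.
- exact: RGenInftyO.measurableE.
- move=> _ _ [x ->] [y ->]; exists (Num.min x y); apply/seteqP; split=> z /=;
    by rewrite !in_itv/= lt_min => /andP.
- by move=> n; exists n%:R.
- rewrite -subTset => x _; exists (Num.trunc `|x|).+1 => //=.
  by rewrite in_itv/= (le_lt_trans (ler_norm x))// truncnS_gt.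
- by move=> _ [x ->]; exact: m12.
- by move=> n; apply: le_lt_trans m1T; apply: le_measure; rewrite ?inE//.
Qed.

(** Sums the comparison over countably many fibres; it serves for cells on which a random threshold
    is almost constant. *)
Lemma le_measure_fibers d (T : measurableType d) (R : realType) (J : countType)
    (m1 m2 : {measure set T -> \bar R}) (A1 A2 : set T) (g : T -> J) :
  measurable A1 -> measurable A2 -> (forall j, measurable (g @^-1` [set j])) ->
  (forall j, (m1 (A1 `&` g @^-1` [set j]) <= m2 (A2 `&` g @^-1` [set j]))%E) ->
  (m1 A1 <= m2 A2)%E.
Proof.
move=> mA1 mA2 mg le_m.
(* Fibres are numbered by [pickle]; a code that is not reached yields the empty set. *)
pose G k := [set w | pickle (g w) = k].
have GE k : (exists j, G k = g @^-1` [set j]) \/ G k = set0.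
  have [[w Gw]|/forallNP G0] := pselect (exists w, G k w).
    left; exists (g w); apply/seteqP; split=> v /=; last by rewrite /G /= => ->.
    by rewrite /G/= -Gw => /(pcan_inj pickleK).
  by right; rewrite -subset0 => w /G0.
have mG k : measurable (G k).
  by have [[j ->]|->] := GE k; [exact: mg|exact: measurable0].
have split_m (m : {measure set T -> \bar R}) A : measurable A ->
    m A = (\sum_(k <oo) m (A `&` G k))%E.
  move=> mA; rewrite -measure_semi_bigcup.
  - by congr (m _); rewrite -setI_bigcupr; apply/seteqP; split=> [w Aw|w []//]; split=> //; exists (pickle (g w)).
  - by move=> k; exact: measurableI.
  - by move=> i j _ _ [w [[_ <-] [_ <-]]].
  - by apply: bigcupT_measurable => k; exact: measurableI.
rewrite (split_m m1)// (split_m m2)//; apply: lee_nneseries => [k _ _|k _]; first exact: measure_ge0.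
by have [[j ->]|->] := GE k; [exact: le_m|rewrite !setI0 !measure0].
Qed.

Lemma lebesgue_unit_lt (R : realType) (x : R) : 0 <= x <= 1 ->
  lebesgue_measure ([set` `]-oo, x[] `&` [set` `]0, 1[]) = x%:E.
Proof.
move=> /andP[x0 x1].
rewrite (_ : _ `&` _ = [set` `]0, x[]).
  rewrite lebesgue_measure_itv/= lte_fin sube0; case: ifPn => //.
  by rewrite -leNgt => x_le0; congr EFin; apply/eqP; rewrite eq_le x0.
apply/seteqP; split=> z /=; rewrite !in_itv/=; first by move=> [-> /andP[-> _]].
by move=> /andP[z0 zx]; rewrite z0 zx (lt_le_trans zx).
Qed.

(** * Quantiles of a distribution function *)

Section distribution_function.
Context (R : realType) (f : R -> R).
Hypothesis f_nd : {homo f : s t / s <= t}.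
Hypothesis f_rc : forall t, f x @[x --> t^'+] --> f t.
Hypothesis f_Ny : f x @[x --> -oo] --> (0 : R).
Hypothesis f_y : f x @[x --> +oo] --> (1 : R).

Lemma distribution_function_ge0 x : 0 <= f x.
Proof.
apply: (cvgr_to_le f_Ny); near=> z; apply: f_nd.
by near: z; exact: (nbhs_ninfty_le (num_real x)).
Unshelve. all: by end_near. Qed.

(** The weak inequality, in contrast to the strict one of [cdf_inv], lets right continuity attain
    the infimum, which yields a Galois connection with [f]. *)
Definition lower_quantile (u : R) : R := inf [set x | u <= f x].

(** The limits at infinity make the set nonempty and bounded below; right continuity then puts the
    infimum in it. *)
Lemma lower_quantile_le u x : 0 < u < 1 -> (lower_quantile u <= x) = (u <= f x).
Proof.
move=> /andP[u0 u1].
have [a fa] : exists a, f a < u.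
  have : \forall z \near -oo, f z < u by exact: (cvgr_lt _ f_Ny).
  by move=> /filter_ex.
have lb : lbound [set x | u <= f x] a.
  move=> z /= ufz; rewrite leNgt; apply/negP => za.
  by have := lt_le_trans fa (le_trans ufz (f_nd (ltW za))); rewrite ltxx.
have [b fb] : exists b, u <= f b.
  have : \forall z \near +oo, u < f z by exact: (cvgr_gt _ f_y).
  by move=> /filter_ex[b /ltW]; exists b.
have hi : has_inf [set x | u <= f x] by split; [exists b|exists a].
apply/idP/idP => [sx|ufx]; last by apply: ge_inf => //; exists a.
suff /le_trans : u <= f (lower_quantile u) by apply; exact: f_nd.
apply: (cvgr_to_ge (f_rc (t := _))); near=> z.
have sz : lower_quantile u < z by near: z; exact: nbhs_right_gt.
have [v /= uv vz] := inf_lt hi.1 sz.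
exact: le_trans uv (f_nd (ltW vz)).
Unshelve. all: by end_near. Qed.

End distribution_function.

Section probability_integral_transform.
Context d d' (T : measurableType d) (S : measurableType d') (R : realType).
Variables (P : probability T R) (W : {mfun T >-> R}) (O : {mfun T >-> S}).
Variable F : R -> S -> R.
Hypothesis mF : measurable_fun setT (fun p : R * S => F p.1 p.2).
Hypothesis F_cdf : forall y : S, {homo F ^~ y : s t / s <= t} /\
     (forall t, F x y @[x --> t^'+] --> F t y) /\
     F x y @[x --> -oo] --> (0:R) /\
     F x y @[x --> +oo] --> (1:R).
Hypothesis F_post : forall (t : R) (B : set S), measurable B ->
  P ([set w | W w <= t] `&` O @^-1` B) = (\int[P]_(w in O @^-1` B) (F t (O w))%:E)%E.

Let mpreO B : measurable B -> measurable (O @^-1` B).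
Proof. by move=> mB; exact: measurable_preim. Qed.

Let F_nd y : {homo F ^~ y : s t / s <= t}. Proof. by have [] := F_cdf y. Qed.

Let F_ge0 x y : 0 <= F x y.
Proof. by have [? [_ [? _]]] := F_cdf y; exact: (@distribution_function_ge0 _ (F ^~ y)). Qed.

Let mFt t : measurable_fun setT (F t).
Proof. exact: (measurable_fun_pair2 t mF). Qed.

Let mFO t (B : set T) : measurable_fun B (fun w => (F t (O w))%:E).
Proof.
apply: measurable_funTS; apply/measurable_EFinP.
exact: (measurableT_comp (mFt t)).
Qed.

(** Outside the open unit interval the infimum may run over an empty or unbounded set. The default
    [0] is harmless, since the transform of [W] lies in the interval almost surely. *)
Definition posterior_quantile (p : R * S) : R :=
  if 0 < p.1 < 1 then lower_quantile (F ^~ p.2) p.1 else 0.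

Lemma posterior_quantile_le u y x :
  0 < u < 1 -> (posterior_quantile (u, y) <= x) = (u <= F x y).
Proof.
move=> u01; rewrite /posterior_quantile/= u01.
by have [? [? [? ?]]] := F_cdf y; exact: lower_quantile_le.
Qed.

(** By the Galois connection, exceeding [x] is the measurable condition [F x y < u] for [u] in the
    unit interval; elsewhere the value is constant. *)
Lemma measurable_posterior_quantile : measurable_fun setT posterior_quantile.
Proof.
apply: measurable_fun_gt_set => x.
pose I := [set p : R * S | 0 < p.1] `&` [set p | p.1 < 1].
have mI : measurable I by apply: measurableI; exact: measurable_set_lt.
have mFx : measurable_fun setT (fun p : R * S => F x p.2).
  exact: (measurableT_comp (mFt x)).
rewrite (_ : [set _ | _] = (I `&` [set p | F x p.2 < p.1]) `|`
   (~` I `&` [set p | x < 0])).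
  apply: measurableU; apply: measurableI => //.
  - exact: measurable_set_lt.
  - exact: measurableC.
  - exact: measurable_set_lt.
apply/seteqP; split=> -[u y] /=.
  have [u01|u01] := boolP (0 < u < 1).
    rewrite ltNge posterior_quantile_le// -ltNge => Fu; left; split=> //.
    exact/andP.
  rewrite /posterior_quantile/= (negPf u01) => x0; right; split=> //.
  by move=> /andP; exact/negP.
move=> [[/andP u01 Fu]|[/andP/negP u01 x0]].
  by rewrite ltNge posterior_quantile_le// -ltNge.
by rewrite /posterior_quantile/=; move/negP: u01 => /= /negbTE ->.
Qed.

(** * The posterior identity at thresholds that depend on the observation *)

Section grid.
Variables (s : S -> R) (v e : R) (B : set S).
Hypotheses (ms : measurable_fun setT s) (v0 : 0 <= v) (e0 : 0 < e) (mB : measurable B).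

(** [F_post] speaks of a constant threshold. Rounding [s] to a grid of mesh [e] makes the threshold
    constant on each of countably many fibres. *)
Let g (y : S) : int := Num.floor (s y / e).

Let mg j : measurable (g @^-1` [set j]).
Proof.
have mse : measurable_fun setT (fun y => s y / e) by exact: measurable_funM.
rewrite (_ : _ @^-1` _ = [set y | j%:~R <= s y / e] `&` [set y | s y / e < (j + 1)%:~R]).
  by apply: measurableI; [exact: measurable_set_le|exact: measurable_set_lt].
apply/seteqP; split=> y /=; rewrite /g.
  by move=> <-; have /andP := floor_itv (s y / e).
by move=> /andP; rewrite -floor_eq => /eqP.
Qed.

Let gP y : (g y)%:~R * e <= s y < (g y + 1)%:~R * e.
Proof. by rewrite -ler_pdivlMr// -ltr_pdivrMr// floor_itv. Qed.

Let mOB j : measurable (O @^-1` (B `&` g @^-1` [set j])).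
Proof. by apply: mpreO; exact: measurableI. Qed.

Let msO c : measurable [set w | W w <= s (O w) + c].
Proof.
apply: measurable_set_le => //.
by apply: measurable_funD => //; exact: measurableT_comp.
Qed.

(** On the fibre of [j] the threshold is rounded up to [(j + 1) * e], which exceeds [s] by at most
    [e]. *)
Lemma posterior_grid_ge : (forall y, v <= F (s y) y) ->
  (v%:E * P (O @^-1` B) <= P ([set w | (W w <= s (O w) + e)%R] `&` O @^-1` B))%E.
Proof.
move=> vF; pose m1 := mscale (NngNum v0) P.
apply: (@le_measure_fibers _ _ _ _ m1 P (O @^-1` B) _ (g \o O)) => [|||j].
- exact: mpreO.
- by apply: measurableI => //; exact: mpreO.
- by move=> j; exact: (mpreO (mg j)).
have OBg : O @^-1` B `&` (g \o O) @^-1` [set j] = O @^-1` (B `&` g @^-1` [set j]).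
  by [].
rewrite -setIA OBg /m1 /mscale/=.
rewrite -[X in (X <= _)%E](integral_cst P (mOB j)).
pose t : R := (j + 1)%:~R * e.
apply: (@le_trans _ _ (P ([set w | (W w <= t)%R] `&` O @^-1` (B `&` g @^-1` [set j])))).
  rewrite F_post; last exact: measurableI.
  apply: ge0_le_integral; [exact: mOB|by move=> w _; rewrite lee_fin|exact: measurable_cst|exact: mFO|].
  move=> w /= [_ gw]; rewrite lee_fin (le_trans (vF (O w)))// F_nd// /t -gw.
  by have /andP[_ /ltW] := gP (O w).
apply: le_measure; rewrite ?inE.
- by apply: measurableI => //; apply: measurable_set_le.
- exact: measurableI.
- move=> w /= [Wt [Bw gw]]; split=> //; apply: (le_trans Wt).
  rewrite /t -gw intrD mulrDl mul1r lerD2r.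
  by have /andP[] := gP (O w).
Qed.

(** Rounding goes to [(j - 1) * e]: one mesh brings the threshold to at most [s], a second strictly
    below it, where the hypothesis bounds [F]. Hence the loss of [2 * e]. *)
Lemma posterior_grid_le : (forall y x, x < s y -> F x y <= v) ->
  (P ([set w | (W w <= s (O w) - 2 * e)%R] `&` O @^-1` B) <= v%:E * P (O @^-1` B))%E.
Proof.
move=> Fv; pose m2 := mscale (NngNum v0) P.
apply: (@le_measure_fibers _ _ _ _ P m2 _ (O @^-1` B) (g \o O)) => [|||j].
- by apply: measurableI => //; exact: mpreO.
- exact: mpreO.
- by move=> j; exact: (mpreO (mg j)).
have OBg : O @^-1` B `&` (g \o O) @^-1` [set j] = O @^-1` (B `&` g @^-1` [set j]).
  by [].
rewrite -setIA OBg /m2 /mscale/=.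
rewrite -[X in (_ <= X)%E](integral_cst P (mOB j)).
pose t : R := (j - 1)%:~R * e.
apply: (@le_trans _ _ (P ([set w | (W w <= t)%R] `&` O @^-1` (B `&` g @^-1` [set j])))).
  apply: le_measure; rewrite ?inE.
  - exact: measurableI.
  - by apply: measurableI => //; apply: measurable_set_le.
  - move=> w /= [Wt [Bw gw]]; split=> //; apply: (le_trans Wt).
    have /andP[_] := gP (O w); rewrite /t -gw intrD intrB.
    by rewrite !mulrDl !mul1r mulN1r => /ltW; lra.
rewrite F_post; last exact: measurableI.
apply: ge0_le_integral.
- exact: mOB.
- by move=> w _; rewrite lee_fin.
- exact: mFO.
- exact: measurable_cst.
- move=> w /= [_ gw]; rewrite lee_fin; apply: Fv; rewrite /t -gw.
  have /andP[+ _] := gP (O w); apply: lt_le_trans.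
  by rewrite ltr_pM2r// ltr_int ltrBlDr ltrDl.
Qed.

End grid.

(* The law of [W] given [O] has no atoms. *)
Hypothesis W_null : forall s : S -> R, measurable_fun setT s ->
  P [set w | W w = s (O w)] = 0%E.

Definition posterior_transform (w : T) : R := F (W w) (O w).
Local Notation U := posterior_transform.

Let mU : measurable_fun setT U.
Proof.
have mWO : measurable_fun setT (fun w => (W w, O w)) by exact: measurable_fun_pair.
exact: (measurableT_comp mF mWO).
Qed.

Let mUlt u : measurable [set w | U w < u].
Proof. exact: measurable_set_lt. Qed.

(** The event says that [W] is below the posterior [u]-quantile [s] of [O]. Grid bounds of mesh
    [1 / (N + 1)] squeeze its mass: from above along increasing events, from below along decreasing
    ones. *)
Lemma posterior_transform_lt u (B : set S) : 0 < u < 1 -> measurable B ->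
  P ([set w | U w < u] `&` O @^-1` B) = (u%:E * P (O @^-1` B))%E.
Proof.
move=> u01 mB; have /andP[u0 u1] := u01.
pose s y := posterior_quantile (u, y).
have ms : measurable_fun setT s.
  exact: (measurable_fun_pair2 u measurable_posterior_quantile).
have sF y x : (s y <= x) = (u <= F x y) by exact: posterior_quantile_le.
have mOB := mpreO mB.
have msO : measurable_fun setT (fun w => s (O w)) by exact: measurableT_comp.
have msOD c : measurable_fun setT (fun w => s (O w) + c).
  by apply: measurable_funD.
have -> : [set w | U w < u] = [set w | W w < s (O w)].
  by apply/seteqP; split=> w /=; rewrite /posterior_transform !ltNge sF.
have ms_lt : measurable [set w | W w < s (O w)] by exact: measurable_set_lt.
have ms_le : measurable [set w | W w <= s (O w)] by exact: measurable_set_le.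
have hi (N : nat) : (0 : R) < N.+1%:R^-1 by rewrite invr_gt0.
have small (x y : R) : x < y -> exists N, x + 2 * N.+1%:R^-1 <= y.
  move=> xy; have xy0 : 0 < (y - x) / 2 by rewrite divr_gt0// subr_gt0.
  have [N] := ltr_add_invr xy0; rewrite add0r => h; exists N.
  by rewrite -lerBrDl mulrC -ler_pdivlMr//; exact: ltW.
have le_hi (i j : nat) : (i <= j)%N -> (j.+1%:R^-1 : R) <= i.+1%:R^-1.
  by move=> ij; rewrite lef_pV2 ?posrE// ler_nat.
apply/eqP; rewrite eq_le; apply/andP; split.
  pose A (N : nat) := [set w | W w <= s (O w) - 2 * N.+1%:R^-1] `&` O @^-1` B.
  have mA N : measurable (A N).
    by apply: measurableI => //; exact: measurable_set_le.
  have AE : \bigcup_N A N = [set w | W w < s (O w)] `&` O @^-1` B.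
    apply/seteqP; split=> w /=.
      move=> [N _ [/= Ws Bw]]; split=> //; apply: le_lt_trans Ws _.
      by rewrite ltrBlDr ltrDl mulr_gt0.
    move=> [/small[N h] Bw]; exists N => //; split=> //=.
    by rewrite lerBrDr.
  have : P (A N) @[N --> \oo] --> P (\bigcup_N A N).
    apply: nondecreasing_cvg_mu => //; first exact: bigcupT_measurable.
    move=> i j ij; apply/subsetPset => w [/= Ws Bw]; split=> //=.
    by rewrite (le_trans Ws)// lerD2l lerN2 ler_pM2l// le_hi.
  rewrite AE; apply: cvge_le; near=> N.
  apply: posterior_grid_le => //; first exact: ltW.
  by move=> y x xs; apply: ltW; rewrite ltNge -sF -ltNge.
(* The decreasing events only reach the weak inequality; [W_null] removes the boundary where [W]
   equals the quantile. *)
apply: (@le_trans _ _ (P ([set w | (W w <= s (O w))%R] `&` O @^-1` B))).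
  pose A (N : nat) := [set w | W w <= s (O w) + N.+1%:R^-1] `&` O @^-1` B.
  have mA N : measurable (A N).
    by apply: measurableI => //; exact: measurable_set_le.
  have AE : \bigcap_N A N = [set w | W w <= s (O w)] `&` O @^-1` B.
    apply/seteqP; split=> w /=.
      move=> h; split; last by have [] := h 0%N Logic.I.
      rewrite leNgt; apply/negP => /small[N sN].
      have [/= WN _] := h N Logic.I; have := le_trans sN WN.
      by rewrite lerD2l leNgt ltr_pMl// ltr1n.
    move=> [Ws Bw] N _; split=> //=.
    by rewrite (le_trans Ws)// lerDl ltW.
  have : P (A N) @[N --> \oo] --> P (\bigcap_N A N).
    apply: nonincreasing_cvg_mu => //.
    - by rewrite (le_lt_trans (probability_le1 _ _))// ltry.
    - exact: bigcapT_measurable.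
    - move=> i j ij; apply/subsetPset => w [/= Ws Bw]; split=> //=.
      by rewrite (le_trans Ws)// lerD2l le_hi.
  rewrite AE; apply: cvge_ge; near=> N.
  apply: posterior_grid_ge => //; first exact: ltW.
  by move=> y; rewrite -sF.
have meq : measurable [set w | W w = s (O w)] by exact: measurable_set_eq.
apply: (@le_trans _ _ (P (([set w | (W w < s (O w))%R] `&` O @^-1` B) `|`
    [set w | W w = s (O w)]))).
  apply: le_measure; rewrite ?inE; first exact: measurableI.
    by apply: measurableU => //; exact: measurableI.
  move=> w /= [+ Bw]; rewrite le_eqVlt => /predU1P[Ws|Ws]; first by right.
  by left.
rewrite measureU0//; first exact: measurableI.
exact: W_null.
Unshelve. all: by end_near. Qed.

(** For fixed [B] both sides are measures in [A], the left one finite, so open half-lines decide. *)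
Lemma posterior_transform_joint (A : set R) (B : set S) :
  measurable A -> measurable B ->
  P (U @^-1` A `&` O @^-1` B) = (lebesgue_measure (A `&` [set` `]0%R, 1%R[]) * P (O @^-1` B))%E.
Proof.
move=> mA mB; have mOB := mpreO mB.
pose m1_ : {measure set R -> \bar R} := pushforward (mrestr P mOB) U.
pose m1 : {measure set R -> \bar R} := m1_ mU.
have m01 : measurable ([set` `]0, 1[] : set R) by exact: measurable_itv.
(* Lebesgue measure lives on [measurableTypeR R]; pushing it along the identity transports it to
   [R]. *)
pose idR : measurableTypeR R -> R := id.
have mid : measurable_fun setT idR by move=> _ X mX; rewrite setTI.
pose l_ : {measure set R -> \bar R} := pushforward (mrestr lebesgue_measure m01) idR.
pose l : {measure set R -> \bar R} := l_ mid.
pose m2 : {measure set R -> \bar R} := mscale (NngNum (pr_ge0 P (O @^-1` B))) l.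
have m1E X : m1 X = P (U @^-1` X `&` O @^-1` B) by [].
have m2E X : m2 X = (lebesgue_measure (X `&` [set` `]0%R, 1%R[]) * P (O @^-1` B))%E.
  by rewrite (prE P mOB) muleC.
have m1T : (m1 setT < +oo)%E.
  by rewrite m1E preimage_setT setTI (le_lt_trans (probability_le1 _ _))// ltry.
suff m12 x : m1 [set` `]-oo, x[] = m2 [set` `]-oo, x[].
  by have := eq_measure_half_lines m1T m12 mA; rewrite m1E m2E.
rewrite m1E m2E.
have UE : U @^-1` [set` `]-oo, x[] = [set w | U w < x].
  by apply/seteqP; split=> w /=; rewrite in_itv.
rewrite UE; have [x0|x0] := leP x 0.
  rewrite (_ : [set w | _] = set0) ?set0I ?measure0; last first.
    by rewrite -subset0 => w /=; rewrite ltNge (le_trans x0 (F_ge0 _ _)).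
  rewrite (_ : _ `&` _ = set0) ?measure0 ?mul0e//.
  rewrite -subset0 => z [/=]; rewrite !in_itv/= => zx /andP[z0 _].
  by have := lt_le_trans zx (le_trans x0 (ltW z0)); rewrite ltxx.
have [x1|x1] := ltP x 1; first by rewrite lebesgue_unit_lt ?posterior_transform_lt ?x0// !ltW.
rewrite (_ : [set` `]-oo, x[] `&` _ = [set` `]0, 1[]); last first.
  apply/seteqP; split=> z /=; first by move=> [].
  by rewrite !in_itv/= => /andP[z0 z1]; rewrite z0 z1 (lt_le_trans z1).
rewrite lebesgue_measure_itv/= lte_fin ltr01 oppr0 adde0 mul1e.
apply/eqP; rewrite eq_le; apply/andP; split.
  by apply: le_measure; rewrite ?inE//; exact: measurableI.
rewrite (prE P mOB); apply/lee_addgt0Pr => e e0.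
(* [posterior_transform_lt] needs a level inside the unit interval, so [1] is approached from below
   with error at most [e]; the bound [2^-1] keeps [v] positive. *)
pose v := 1 - Num.min e (2^-1).
have e12 : 0 < Num.min e 2^-1 <= 2^-1 by rewrite lt_min e0 ge_min lexx orbT invr_gt0 ltr0n.
have v01 : 0 < v < 1 by rewrite /v; move: e12; lra.
apply: (@le_trans _ _ ((v%:E * P (O @^-1` B)) + e%:E)%E).
  rewrite (prE P mOB) -EFinM -EFinD lee_fin /v mulrBl mul1r -addrA lerDl.
  rewrite addrC subr_ge0 -[leRHS]mulr1 ler_pM ?pr_ge0//.
  - by move: e12; lra.
  - by rewrite ge_min lexx.
  - by rewrite -lee_fin -prE// probability_le1.
apply: leeD => //; rewrite -posterior_transform_lt//.
apply: le_measure; rewrite ?inE//; try exact: measurableI.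
by move=> w [/= Uv Bw]; split=> //=; move: v01 => /andP[_ v1]; rewrite (lt_trans Uv)// (lt_le_trans v1).
Qed.

Lemma posterior_transform_uniform : uniform01 P U.
Proof.
move=> A mA; have := posterior_transform_joint mA measurableT.
by rewrite preimage_setT setIT probability_setT mule1.
Qed.

Lemma posterior_transform_indep : indep_rv P U O.
Proof.
by move=> A B mA mB; rewrite posterior_transform_joint// posterior_transform_uniform.
Qed.

(** By independence the joint law of [O] and [U] is a product, and the graph of [f] has singleton
    sections, null for the uniform law. *)
Lemma posterior_transform_neq (f : S -> R) : measurable_fun setT f ->
  P [set w | U w = f (O w)] = 0%E.
Proof.
move=> mf.
pose Um : {mfun T >-> R} := HB.pack U (isMeasurableFun.Build _ _ _ _ _ mU).
have mOU : measurable_fun setT (fun w => (O w, U w)) by exact: measurable_fun_pair.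
pose OU : {mfun T >-> (S * R)%type} := HB.pack (fun w => (O w, U w))
  (isMeasurableFun.Build _ _ _ _ _ mOU).
have mD : measurable [set p : S * R | p.2 = f p.1].
  apply: measurable_set_eq; first exact: measurable_snd.
  by apply: measurableT_comp => //; exact: measurable_fst.
have rect A B : measurable A -> measurable B ->
    distribution P OU (A `*` B) = (distribution P O A * distribution P Um B)%E.
  move=> mA mB; rewrite muleC -[RHS](posterior_transform_indep mB mA).
  by rewrite setIC.
have := product_measure_unique rect mD; rewrite -[RHS]/(P [set w | U w = f (O w)]) => <-.
apply: integral0_eq => y _.
rewrite /= (_ : xsection _ y = [set f y]); last first.
  by apply/seteqP; split=> z; rewrite /xsection/= inE.
rewrite /distribution /pushforward (posterior_transform_uniform (measurable_set1 _)).
apply: subset_measure0 (lebesgue_measure_set1 (f y)); [|exact: measurable_set1|by move=> z []].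
by apply: measurableI => //; exact: measurable_itv.
Qed.

(** For [U] in the unit interval its quantile is at most [W]. If it is strictly smaller, a rational
    between the two lies on a flat stretch of the posterior c.d.f., so [U] equals [F] at that
    rational: a null event for each of countably many rationals. *)
Lemma posterior_quantileK : {ae P, forall w, W w = posterior_quantile (U w, O w)}.
Proof.
pose N := U @^-1` (~` [set` `]0, 1[]) `|` \bigcup_(q in [set: rat]) [set w | U w = F (ratr q) (O w)].
have mN q : measurable [set w | U w = F (ratr q) (O w)].
  by apply: measurable_set_eq => //; exact: (measurableT_comp (mFt _)).
have m01 : measurable (~` [set` `]0, 1[] : set R).
  by apply: measurableC; exact: measurable_itv.
exists N; split.
- apply: measurableU; first exact: measurable_preim.
  exact: bigcupT_measurable_rat.
- apply: null_set_setU; first exact: measurable_preim.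
  + exact: bigcupT_measurable_rat.
  + by have := posterior_transform_uniform m01; rewrite setICl measure0.
  + apply/negligibleP; first exact: bigcupT_measurable_rat.
    have -> : \bigcup_(q in [set: rat]) [set w | U w = F (ratr q) (O w)] =
        \bigcup_n [set w | exists2 q, unpickle n = Some q & U w = F (ratr q) (O w)].
      apply/seteqP; split=> [w [q _ /= Uq]|w [n _ /= [q _ Uq]]]; last by exists q.
      by exists (pickle q) => //=; exists q => //; rewrite pickleK.
    apply: negligible_bigcup => n; case nq : (unpickle n) => [q|]; last first.
      by apply: (negligibleS _ (negligible_set0 P)) => w /= [].
    apply: (@negligibleS _ _ _ _ [set w | U w = F (ratr q) (O w)]).
      by move=> w /= [_ [<-]].
    by apply/negligibleP => //; exact: posterior_transform_neq.
- move=> w /=; apply: contra_notP => /not_orP[/= U01 UF].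
  have {}U01 : 0 < U w < 1 by move/contrapT: U01; rewrite in_itv.
  apply/eqP; rewrite eq_le posterior_quantile_le// lexx andbT leNgt; apply/negP.
  move=> /rat_in_itvoo[q]; rewrite in_itv/= => /andP[sq qW]; apply: UF; exists q => //=.
  apply/eqP; rewrite eq_le; apply/andP; split; last exact/F_nd/ltW.
  by rewrite -posterior_quantile_le//; exact: ltW.
Qed.

End probability_integral_transform.

(** * Quantile transform *)

Section quantile_transform.
Context (R : realType) (mu : probability R R).

Let mitv (i : interval R) : measurable ([set` i] : set R).
Proof. exact: measurable_itv. Qed.

(** The identity as a random variable under [mu] gives access to the limits of [random_variable.cdf]
    at both infinities. *)
Let idX : {mfun R >-> R} := HB.pack (@idfun R)
  (isMeasurableFun.Build _ _ _ _ _ (@measurable_id _ R setT)).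

Let cdf_pr x : Defs.cdf mu x = pr mu [set` `]-oo, x]]. Proof. by []. Qed.

Let cdf_nd : {homo Defs.cdf mu : x y / x <= y}.
Proof. by move=> x y xy; apply: le_pr => //; exact: subset_itvl. Qed.

Let cdf_ge0 x : 0 <= Defs.cdf mu x. Proof. exact: pr_ge0. Qed.

Let cdf_le1 x : Defs.cdf mu x <= 1.
Proof. by rewrite cdf_pr -lee_fin -prE// probability_le1. Qed.

Let cdf_lt_ex t : 0 < t -> exists x, Defs.cdf mu x < t.
Proof.
move=> t0.
have t0' : (0 < t%:E)%E by rewrite lte_fin.
have /filter_ex[x xt] : \forall x \near -oo, (random_variable.cdf (P := mu) idX x < t%:E)%E.
  exact: (cvg_cdfNy0 (P := mu) idX (open_ereal_lt' t0')).
exists x; by rewrite cdf_pr -lte_fin -prE.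
Qed.

Let cdf_gt_ex t : t < 1 -> exists x, t < Defs.cdf mu x.
Proof.
move=> t1.
have t1' : (t%:E < 1%:E)%E by rewrite lte_fin.
have /filter_ex[x xt] : \forall x \near +oo, (t%:E < random_variable.cdf (P := mu) idX x)%E.
  exact: (cvg_cdfy1 (P := mu) idX (open_ereal_gt' t1')).
exists x; by rewrite cdf_pr -lte_fin -prE.
Qed.

(** The strict inequality inside [cdf_inv] pairs with open half-lines. One direction is the
    definition of the infimum; for the other, continuity from below finds some [x - 1 / (n + 1)]
    where the c.d.f. already exceeds [t]. *)
Lemma cdf_inv_lt t x : 0 < t < 1 ->
  (cdf_inv mu t < x) = (t < pr mu [set` `]-oo, x[]).
Proof.
move=> /andP[t0 t1]; have [b tb] := cdf_gt_ex t1; have [a at_] := cdf_lt_ex t0.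
apply/idP/idP => [/inf_lt[]|tx]; first by exists b.
  move=> v /= tv vx; apply: (lt_le_trans tv); apply: le_pr => // z /=.
  by rewrite !in_itv/= => /le_lt_trans; exact.
pose A (n : nat) : set R := [set` `]-oo, x - n.+1%:R^-1]].
have AE : \bigcup_n A n = [set` `]-oo, x[].
  apply/seteqP; split=> z /=; rewrite /A.
    move=> [n _ /=]; rewrite !in_itv/= => zx; apply: (le_lt_trans zx).
    by rewrite ltrBlDr ltrDl invr_gt0.
  rewrite in_itv/= => /ltr_add_invr[n zn]; exists n => //=.
  by rewrite in_itv/= lerBrDr ltW.
have : mu (A n) @[n --> \oo] --> mu (\bigcup_n A n).
  apply: nondecreasing_cvg_mu => [n||i j ij]; [exact: mitv|by rewrite AE; exact: mitv|].
  apply/subsetPset => z; rewrite /A/= !in_itv/= => /le_trans; apply.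
  by rewrite lerD2l lerN2 lef_pV2 ?posrE// ler_nat.
rewrite AE => /(_ [set y | t%:E < y]%E)[].
  by apply: open_ereal_gt'; rewrite prE.
move=> n _ /(_ n (leqnn n)) tA0.
have tA : t < pr mu (A n) by rewrite -lte_fin -prE//; exact: mitv.
apply: (@le_lt_trans _ _ (x - n.+1%:R^-1)); last by rewrite ltrBlDr ltrDl invr_gt0.
apply: ge_inf => //; exists a => z /= tz; rewrite leNgt; apply/negP => za.
by have := lt_trans at_ (lt_le_trans tz (cdf_nd (ltW za))); rewrite ltxx.
Qed.

Lemma measurable_cdf_inv : measurable_fun setT (cdf_inv mu).
Proof.
apply: (measurability _ (RGenInftyO.measurableE R)) => // _ [_ [x ->] <-].
rewrite setTI.
(* For [t < 0] and [1 <= t] the infimum in [cdf_inv] has a junk value. *)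
have neg t : t < 0 -> cdf_inv mu t = inf [set: R].
  move=> t0; congr inf; apply/seteqP; split=> // z _ /=.
  exact: lt_le_trans (cdf_ge0 z).
have ge1 t : 1 <= t -> cdf_inv mu t = inf set0.
  move=> t1; congr inf; rewrite -subset0 => z /=.
  by rewrite ltNge (le_trans (cdf_le1 z)).
pose g := pr mu [set` `]-oo, x[].
(* The point [0] is treated apart: whatever the value there, its contribution is a singleton or
   empty. *)
have m0 : measurable ([set 0] `&` [set t | cdf_inv mu t < x]).
  have [h|h] := pselect (cdf_inv mu 0 < x).
    rewrite setIidl; first exact: measurable_set1.
    by move=> t ->.
  rewrite (_ : _ `&` _ = set0)//; first by rewrite -subset0 => t [/= ->].
have -> : cdf_inv mu @^-1` [set` `]-oo, x[] =
   ([set` `]0, 1[] `&` [set` `]-oo, g[]) `|` ([set 0] `&` [set t | cdf_inv mu t < x]) `|`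
   ([set` `]-oo, 0[] `&` [set _ | inf [set: R] < x]) `|`
   ([set` `[1, +oo[] `&` [set _ | inf (@set0 R) < x]).
  apply/seteqP; split=> t /=.
    rewrite in_itv/= => tx.
    have [t0|t0|t0] := ltgtP t 0.
    - by left; right; rewrite in_itv/= -(neg _ t0).
    - have [t1|t1] := leP 1 t; first by right; rewrite in_itv/= andbT -(ge1 _ t1).
      by left; left; left; rewrite !in_itv/= t0 t1 /g -cdf_inv_lt// t0.
    - by left; left; right; rewrite -t0.
  rewrite !in_itv/= andbT => -[[[[t01 tg]|[-> //]]|[t0]]|[t1]].
  - by rewrite cdf_inv_lt.
  - by rewrite neg.
  - by rewrite ge1.
have mc (b : bool) : measurable [set _ : R | b].
  case: b.
    have -> : [set _ : R | true] = setT by apply/seteqP; split.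
    exact: measurableT.
  have -> : [set _ : R | false] = set0 by apply/seteqP; split.
  exact: measurable0.
by apply: measurableU; [apply: measurableU; [apply: measurableU|]|] => //;
  apply: measurableI.
Qed.

(** Inverse transform sampling: within the unit interval, the points sent below [x] are those below
    the mass of []-oo, x[], an interval of that length. *)
Lemma cdf_inv_uniform_law d (T : measurableType d) (P : probability T R) (U : T -> R) :
  measurable_fun setT U -> uniform01 P U ->
  has_law P (fun w => cdf_inv mu (U w)) mu.
Proof.
move=> mU U01 A mA; pose X w := cdf_inv mu (U w).
have mX : measurable_fun setT X.
  by apply: (measurableT_comp measurable_cdf_inv).
pose m1_ : {measure set R -> \bar R} := pushforward P X.
pose m1 : {measure set R -> \bar R} := m1_ mX.
have m1T : (m1 setT < +oo)%E.
  by rewrite /m1 /m1_/= /pushforward preimage_setT probability_setT ltry.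
suff m12 x : m1 [set` `]-oo, x[] = mu [set` `]-oo, x[].
  exact: (eq_measure_half_lines m1T m12 mA).
rewrite /m1 /m1_/= /pushforward.
have mq : measurable (cdf_inv mu @^-1` [set` `]-oo, x[]).
  by apply: measurable_preim => //; exact: measurable_cdf_inv.
transitivity (lebesgue_measure ((cdf_inv mu @^-1` [set` `]-oo, x[]) `&` [set` `]0, 1[])).
  exact: U01.
have -> : (cdf_inv mu @^-1` [set` `]-oo, x[]) `&` [set` `]0, 1[] =
    [set` `]-oo, (pr mu [set` `]-oo, x[])[] `&` [set` `]0, 1[].
  apply/seteqP; split=> t /=; rewrite !in_itv/= => -[+ t01].
    by rewrite cdf_inv_lt.
  by rewrite -cdf_inv_lt.
rewrite lebesgue_unit_lt ?prE// pr_ge0 -lee_fin -prE//.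
exact: probability_le1.
Qed.

End quantile_transform.

(** * Induction on the number of channel uses *)

Section output_vector.
Context {T : Type} {R : realType} (Y : nat -> T -> R).

Lemma outsS n w : outs Y n.+1 w = rcons_tuple (outs Y n w) (Y n w).
Proof.
apply: eq_from_tnth => i; rewrite tnth_mktuple (tnth_nth 0) nth_rcons size_tuple.
case: ltnP => ni.
  have -> : nth 0 (outs Y n w) i = tnth (outs Y n w) (Ordinal ni).
    by rewrite (tnth_nth 0).
  by rewrite tnth_mktuple.
have {ni}ni : i = n :> nat by apply/eqP; rewrite eqn_leq ni -ltnS ltn_ord.
by rewrite ni eqxx.
Qed.

End output_vector.

Lemma measurable_outs d (T : measurableType d) (R : realType) (Y : nat -> T -> R) n :
  (forall k, measurable_fun setT (Y k)) -> measurable_fun setT (outs Y n).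
Proof.
move=> mY; apply/measurable_fun_tnthP => i.
rewrite (_ : _ \o _ = Y i)//; apply/funext => w /=.
by rewrite tnth_mktuple.
Qed.

Lemma measurable_fun_rcons_tuple d (T : measurableType d) (R : realType) n
    (f : T -> n.-tuple R) (g : T -> R) :
  measurable_fun setT f -> measurable_fun setT g ->
  measurable_fun setT (fun w => rcons_tuple (f w) (g w)).
Proof.
move=> mf mg; apply/measurable_fun_tnthP => i.
have [ni|ni] := ltnP i n.
  rewrite (_ : _ \o _ = (fun y => tnth y (Ordinal ni)) \o f).
    exact: (measurableT_comp (measurable_tnth _)).
  by apply/funext => w /=; rewrite !(tnth_nth 0)/= nth_rcons size_tuple ni.
rewrite (_ : _ \o _ = g)//; apply/funext => w /=.
rewrite (tnth_nth 0)/= nth_rcons size_tuple ltnNge ni/=.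
by rewrite (_ : i == n :> nat)// eqn_leq ni -ltnS ltn_ord.
Qed.

(** As [X] has law [PX], integrating the kernel against [PX] amounts to integrating it along [X]. So
    [joint_rect] is the probability of a rectangle for the pair, and [out_prob] is its case
    [A = setT]. *)
Lemma information_le_channel d (T : measurableType d) (R : realType)
    (P : probability T R) (PX : probability R R) (K : R.-pker R ~> R)
    (X Y : T -> R) (M : R) :
  measurable_fun setT X -> has_law P X PX ->
  (forall A B, measurable A -> measurable B ->
     P (X @^-1` A `&` Y @^-1` B) = (\int[P]_(w in X @^-1` A) K (X w) B)%E) ->
  (forall (m k : nat) (A : 'I_m -> set R) (B : 'I_k -> set R),
    meas_partition A -> meas_partition B ->
    \sum_(i < m) \sum_(j < k)
       (joint_rect PX K (A i) (B j) *
        ln (joint_rect PX K (A i) (B j) /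
            (fine (PX (A i)) * out_prob PX K (B j)))) <= M) ->
  information_le P X Y M.
Proof.
move=> mX lawX chan hM m k A B mA mB; apply: le_trans (hM m k A B mA mB).
pose m1_ : {measure set R -> \bar R} := pushforward P X.
pose m1 : {measure set R -> \bar R} := m1_ mX.
have joint A' B' : measurable A' -> measurable B' ->
    pr P (X @^-1` A' `&` Y @^-1` B') = joint_rect PX K A' B'.
  move=> mA' mB'; rewrite /pr /joint_rect chan//; congr fine.
  have mK : measurable_fun A' (fun x => K x B').
    by apply: measurable_funTS; exact: (measurable_kernel K _ mB').
  transitivity (\int[m1]_(x in A') K x B')%E.
    by rewrite (ge0_integral_pushforward mX P mA' mK).
  by apply: eq_measure_integral => C mC _; exact: lawX.
apply: ler_sum => i _; apply: ler_sum => j _; have [mAi _] := mA; have [mBj _] := mB.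
have YB : pr P (Y @^-1` B j) = out_prob PX K (B j).
  by have := joint setT (B j) measurableT (mBj j); rewrite preimage_setT setTI.
by rewrite joint// YB /pr lawX.
Qed.

Unset Implicit Arguments.
Set Strict Implicit.
Set Printing Implicit Defensive.

Theorem mainTheorem6 (R : realType) (PX : probability R R) (K : R.-pker R ~> R)
  (d : measure_display) (T : measurableType d) (P : probability T R)
  (Theta0 : T -> R) (X Y : nat -> T -> R) (F : forall n : nat, R -> n.-tuple R -> R) :
  (* standing assumption: real laws are mixtures of a.c. and discrete parts *)
  ac_discrete_mixture PX ->
  (forall x, ac_discrete_mixture (K x)) ->
  (* (P_X, P_{Y|X}) is an input/channel pair *)
  input_channel_pair PX K ->
  (* message point Theta0 ~ U(0,1) *)
  measurable_fun setT Theta0 -> uniform01 P Theta0 ->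
  (forall n, measurable_fun setT (Y n)) ->
  (* F n is the posterior c.d.f. F_{Theta0|Y^n} *)
  (forall n, posterior_cdf P Theta0 Y (F n)) ->
  (* the scheme: X n = X_{n+1} = F_X^{-1}(F_{Theta0|Y^n}(Theta0 | Y^n)) *)
  (forall n w, X n w = cdf_inv PX (F n (Theta0 w) (outs Y n w))) ->
  (* memoryless channel: given (Theta0, Y^n) (hence X^{n+1}), Y_{n+1} ~ P_{Y|X}(. | X_{n+1}) *)
  (forall n (A : set (R * n.-tuple R)) (B : set R), measurable A -> measurable B ->
     P ((fun w => (Theta0 w, outs Y n w)) @^-1` A `&` Y n @^-1` B) =
     (\int[P]_(w in (fun w => (Theta0 w, outs Y n w)) @^-1` A) K (X n w) B)%E) ->
  forall n : nat,
    let U := fun w => F n (Theta0 w) (outs Y n w) in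
    [/\ uniform01 P U,
        indep_rv P U (outs Y n),
        (exists h : R * n.-tuple R -> R, measurable_fun setT h /\
           {ae P, forall w, Theta0 w = h (U w, outs Y n w)}),
        has_law P (X n) PX &
        indep_rv P (X n) (outs Y n)].
Proof.
move=> _ _ [M hM] mTheta Theta01 mY post XE chan.
pose Th : {mfun T >-> R} := HB.pack Theta0 (isMeasurableFun.Build _ _ _ _ _ mTheta).
pose O n : {mfun T >-> n.-tuple R} :=
  HB.pack (outs Y n) (isMeasurableFun.Build _ _ _ _ _ (measurable_outs mY)).
pose Yf n : {mfun T >-> R} := HB.pack (Y n) (isMeasurableFun.Build _ _ _ _ _ (mY n)).
(* Arbitrary sets rather than graphs: the induction step applies the hypothesis to sections of a
   general set. *)
pose null n := forall N : set (R * n.-tuple R), measurable N ->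
  (forall y, P (Theta0 @^-1` ysection N y) = 0%E) ->
  P ((fun w => (Theta0 w, outs Y n w)) @^-1` N) = 0%E.
have mF n : measurable_fun setT (fun p : R * n.-tuple R => F n p.1 p.2).
  by have [] := post n.
have mU n : measurable_fun setT (fun w => F n (Theta0 w) (outs Y n w)).
  have mTO : measurable_fun setT (fun w => (Theta0 w, outs Y n w)).
    by apply: measurable_fun_pair => //; exact: measurable_outs.
  exact: (measurableT_comp (mF n) mTO).
(* A graph has singleton sections, null for the uniform [Theta0]; this supplies [W_null]. *)
have graph_null n : null n -> forall s : n.-tuple R -> R, measurable_fun setT s ->
    P [set w | Th w = s (O n w)] = 0%E.
  move=> nulln s ms.
  have mN : measurable [set p : R * n.-tuple R | p.1 = s p.2].
    apply: measurable_set_eq; first exact: measurable_fst.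
    by apply: measurableT_comp => //; exact: measurable_snd.
  apply: (nulln _ mN) => y.
  have -> : ysection [set p : R * n.-tuple R | p.1 = s p.2] y = [set s y].
    by apply/seteqP; split=> z; rewrite /ysection/= inE.
  rewrite Theta01; last exact: measurable_set1.
  apply: subset_measure0 (lebesgue_measure_set1 (s y)); [|exact: measurable_set1|by move=> z []].
  by apply: measurableI => //; exact: measurable_itv.
have unif n : null n -> uniform01 P (fun w => F n (Theta0 w) (outs Y n w)).
  move=> nulln; have [_ [Fcdf Fpost]] := post n.
  exact: (@posterior_transform_uniform _ _ _ _ _ P Th (O n) (F n) (mF n) Fcdf Fpost (graph_null n nulln)).
have mXn n : measurable_fun setT (X n).
  rewrite (_ : X n = cdf_inv PX \o (fun w => F n (Theta0 w) (outs Y n w))).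
    exact: (measurableT_comp (measurable_cdf_inv PX)).
  by apply/funext => w; rewrite XE.
have lawX n : null n -> has_law P (X n) PX.
  move=> nulln; rewrite (_ : X n = (fun w => cdf_inv PX (F n (Theta0 w) (outs Y n w)))).
    by apply: cdf_inv_uniform_law => //; exact: unif.
  by apply/funext => w; rewrite XE.
have nullP n : null n.
  elim: n => [|n nulln] N mN N0.
    (* Without outputs, [N] is determined by its section at the empty tuple. *)
    apply: etrans (N0 [tuple]); congr (P _); apply/seteqP.
    by split=> w /=; rewrite /ysection/= inE (tuple0 (outs Y 0 w)).
  have mZ : measurable_fun setT (fun w => (Theta0 w, outs Y n w)).
    by apply: measurable_fun_pair => //; exact: measurable_outs.
  pose Z : {mfun T >-> (R * n.-tuple R)%type} :=
    HB.pack (fun w => (Theta0 w, outs Y n w)) (isMeasurableFun.Build _ _ _ _ _ mZ).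
  pose phi0 (p : R * n.-tuple R) := cdf_inv PX (F n p.1 p.2).
  have mphi : measurable_fun setT phi0 by exact: (measurableT_comp (measurable_cdf_inv PX) (mF n)).
  pose phi : {mfun (R * n.-tuple R)%type >-> R} :=
    HB.pack phi0 (isMeasurableFun.Build _ _ _ _ _ mphi).
  have phiZ : phi \o Z = X n by apply/funext => w; rewrite XE.
  have chann (A : set (R * n.-tuple R)) (B : set R) : measurable A -> measurable B ->
      P (Z @^-1` A `&` Yf n @^-1` B) = (\int[P]_(w in Z @^-1` A) K (phi (Z w)) B)%E.
    move=> mA mB; apply: etrans (chan n A B mA mB) _.
    by apply: eq_integral => w _; rewrite XE.
  (* The induction hypothesis enters first here, giving the input the law [PX] for which the
     information is bounded, and again below on sections. *)
  have info : information_le P (phi \o Z) (Yf n) M.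
    rewrite phiZ; apply: (information_le_channel (mXn n) (lawX n nulln)) hM.
    move=> A B mA mB; rewrite -phiZ comp_preimage chann//.
    by apply: measurable_preim.
  (* Regrouping turns a set over [n + 1] outputs into one over [Z] and the next output. *)
  pose app (q : (R * n.-tuple R) * R) : R * n.+1.-tuple R :=
    (q.1.1, rcons_tuple q.1.2 q.2).
  have mapp : measurable_fun setT app.
    apply: measurable_fun_pair; first exact: (measurableT_comp measurable_fst measurable_fst).
    apply: measurable_fun_rcons_tuple; last exact: measurable_snd.
    exact: (measurableT_comp measurable_snd measurable_fst).
  have mC : measurable (app @^-1` N) by exact: measurable_preim.
  apply: etrans (channel_joint_negligible chann info mC _).
    by congr (P _); apply/seteqP; split=> w /=; rewrite outsS.
  (* Sections compose: the section at [y] of the section at [y'] is that of [N] at the tuple [y]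
     extended by [y']. *)
  move=> y'; apply: nulln; first exact: measurable_ysection.
  move=> y; apply: etrans (N0 (rcons_tuple y y')); congr (P _); apply/seteqP.
  by split=> w /=; rewrite /ysection/= !inE /= inE.
move=> n U; have [_ [Fcdf Fpost]] := post n.
have indepU : indep_rv P U (outs Y n).
  exact: (@posterior_transform_indep _ _ _ _ _ P Th (O n) (F n) (mF n) Fcdf Fpost (graph_null n (nullP n))).
have XU : X n = cdf_inv PX \o U by apply/funext => w; rewrite XE.
split.
- exact: unif.
- exact: indepU.
- exists (posterior_quantile (F n)); split.
    exact: (measurable_posterior_quantile (mF n) Fcdf).
  exact: (@posterior_quantileK _ _ _ _ _ P Th (O n) (F n) (mF n) Fcdf Fpost (graph_null n (nullP n))).
- exact: lawX.
- move=> A B mA mB; rewrite XU comp_preimage; apply: indepU => //.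
  by apply: measurable_preim => //; exact: measurable_cdf_inv.
Qed.
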